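(* Let $r\ge 1$, let $a_r>\cdots>a_1>a_0\ge 2$ be integers, and choose $k\in\{1,\dots,r-1\}$. Then, for fixed $a_0,\dots,a_k$ and $a_{k+1},\dots,a_r\to\infty$, the Salem root $\tau(a_0,\dots,a_r)$ of the Coxeter polynomial associated with $T(a_0,\dots,a_r)$ converges to the dominant Pisot root of $$Q(z)=(z+1-r+k)\prod_{i=0}^{k}(z^{a_i}-1)-z\sum_{i=0}^{k}(z^{a_i-1}-1)\prod_{\substack{j=0\\ j\neq i}}^{k}(z^{a_j}-1),$$ i.e. to the root of $Q$ of largest modulus, which is a Pisot number.
   Context: For integers $a_0,\dots,a_r\ge 2$, the star-like tree $T(a_0,\dots,a_r)$ is the tree consisting of $r+1$ arms (paths) with $a_0-1,\dots,a_r-1$ edges, respectively, all emanating from one common central vertex. Its Coxeter polynomial is given by $$R_{T(a_0,\dots,a_r)}(z)=\prod_{i=0}^{r}\Bigl(\frac{z^{a_i}-1}{z-1}\Bigr)\Bigl(z+1-z\sum_{i=0}^{r}\frac{z^{a_i-1}-1}{z^{a_i}-1}\Bigr).$$ The Salem root $\tau(a_0,\dots,a_r)$ is the unique root of modulus greater than $1$ of this polynomial (it exists for $a_{k+1},\dots,a_r$ sufficiently large); it is real and $>1$, and is a Salem number or a quadratic Pisot number. A Pisot number is a real algebraic integer $>1$ all of whose other conjugates have modulus $<1$. The limit $a_{k+1},\dots,a_r\to\infty$ is taken over integers subject to $a_k<a_{k+1}<\cdots<a_r$, with all of $a_{k+1},\dots,a_r$ tending to infinity. *)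

(* Defs.v *)
From HB Require Import structures.
From mathcomp Require Import all_boot all_order all_algebra.
From mathcomp Require Import all_classical all_reals all_analysis.
From mathcomp Require Import complex.

Set Implicit Arguments.
Unset Strict Implicit.
Unset Printing Implicit Defensive.

Import Order.TTheory GRing.Theory Num.Theory numFieldNormedType.Exports.

Local Open Scope classical_set_scope.
Local Open Scope complex_scope.
Local Open Scope ring_scope.

(* A family a_0, ..., a_r is encoded by a function a : nat -> nat of which only
   the values at 0, ..., r are used. *)

(* ('X^n - 1) / ('X - 1) as a polynomial. *)
Definition geom_poly (K : nzRingType) (n : nat) : {poly K} :=
  \sum_(j < n) 'X^j.

(* The Coxeter polynomial of T(a_0, ..., a_r) with its denominators cleared;
   coxeter_polyE recovers the rational expression. *)
Definition coxeter_poly (K : nzRingType) (r : nat) (a : nat -> nat) : {poly K} :=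
  ('X + 1) * \prod_(i < r.+1) geom_poly K (a i)
  - 'X * \sum_(i < r.+1)
      geom_poly K (a i).-1 * \prod_(j < r.+1 | j != i) geom_poly K (a j).

Definition limit_poly (K : nzRingType) (r k : nat) (a : nat -> nat) : {poly K} :=
  ('X + 1 - r%:R + k%:R) * \prod_(i < k.+1) ('X^(a i) - 1)
  - 'X * \sum_(i < k.+1)
      ('X^((a i).-1) - 1) * \prod_(j < k.+1 | j != i) ('X^(a j) - 1).

Lemma horner_geom_poly (F : fieldType) (n : nat) (z : F) :
  z != 1 -> (geom_poly F n).[z] = (z ^+ n - 1) / (z - 1).
Proof.
move=> z1; have z1' : z - 1 != 0 by rewrite subr_eq0.
rewrite /geom_poly horner_sum subrX1 mulrC mulKf //.
by apply: eq_bigr => i _; rewrite hornerXn.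
Qed.

Lemma coxeter_polyE (F : fieldType) (r : nat) (a : nat -> nat) (z : F) :
  (forall i : nat, (i <= r)%N -> z ^+ a i != 1) ->
  (coxeter_poly F r a).[z] =
    (\prod_(i < r.+1) ((z ^+ a i - 1) / (z - 1))) *
    (z + 1 - z * \sum_(i < r.+1) (z ^+ (a i).-1 - 1) / (z ^+ a i - 1)).
Proof.
move=> za; have z1 : z != 1.
  by apply: contra (za 0%N isT) => /eqP ->; rewrite expr1n.
rewrite /coxeter_poly !hornerE mulrBr [in RHS]mulrC; congr (_ - _).
  rewrite horner_prod; congr (_ * _).
  by apply: eq_bigr => i _; rewrite horner_geom_poly.
rewrite mulrCA; congr (_ * _); rewrite horner_sum mulr_sumr.
apply: eq_bigr => i _; rewrite [in RHS](bigD1 i) //= hornerM horner_prod.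
rewrite horner_geom_poly // [RHS]mulrAC; congr (_ * _); last first.
  by apply: eq_bigr => j _; rewrite horner_geom_poly.
have zi : z ^+ a i - 1 != 0 by rewrite subr_eq0 za // -ltnS.
by rewrite [RHS]mulrC mulrA divfK.
Qed.

Definition is_salem_root (R : realType) (r : nat) (a : nat -> nat) (t : R) :=
  [/\ 1 < t, root (coxeter_poly R[i] r a) t%:C
    & forall z : R[i],
        root (coxeter_poly R[i] r a) z -> 1 < `|z| -> z = t%:C].

(* Takes the junk value 0 if there is no Salem root. *)
Definition salem_root (R : realType) (r : nat) (a : nat -> nat) : R :=
  xget 0 [set t | is_salem_root r a t].

(* x and y are roots of the same minimal polynomial over the rationals. *)
Definition conjugates (K : fieldType) (x y : K) :=
  exists p : {poly rat},
    [/\ p \is monic, irreducible_poly p,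
        root (map_poly ratr p) x & root (map_poly ratr p) y].

Definition is_pisot (R : realType) (x : R) :=
  [/\ integralOver (intr : int -> R) x, 1 < x
    & forall y : R[i], conjugates x%:C y -> y != x%:C -> `|y| < 1].

Definition is_dominant_root (R : realType) (p : {poly R[i]}) (x : R) :=
  root p x%:C /\ forall y : R[i], root p y -> y != x%:C -> `|y| < `|x%:C|.

Definition long_arms (r k : nat) (a : nat -> nat) (N : nat) : set (nat -> nat) :=
  [set b | [/\ forall i, (i <= k)%N -> b i = a i,
               forall i, (k <= i < r)%N -> (b i < b i.+1)%N
             & forall i, (k < i <= r)%N -> (N <= b i)%N]].

(* The filter "a_(k+1), ..., a_r tend to infinity, subject to
   a_k < a_(k+1) < ... < a_r, with a_0, ..., a_k fixed". *)
Definition long_arms_filter (r k : nat) (a : nat -> nat) :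
    set_system (nat -> nat) :=
  filter_from setT (long_arms r k a).

Instance long_arms_filter_proper (r k : nat) (a : nat -> nat) :
  ProperFilter (long_arms_filter r k a).
Proof.
apply: filter_from_proper; first apply: filter_fromT_filter.
- by exists 0%N.
- move=> M N; exists (maxn M N) => b [ba bi bN].
  by split; split=> // i /bN; rewrite geq_max => /andP[].
move=> N _; exists (fun i => if (i <= k)%N then a i else (a k + N + i)%N).
split=> i.
- by move=> ->.
- move=> /andP[ki _]; rewrite [(i.+1 <= k)%N]leqNgt ltnS ki /=.
  case: (leqP i k) => ik; last by rewrite addnS leqnn.
  have -> : i = k by apply/eqP; rewrite eqn_leq ik ki.
  by rewrite addnS ltnS -addnA leq_addr.
- by move=> /andP[ki _]; rewrite [(i <= k)%N]leqNgt ki /= addnAC leq_addl.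
Qed.

(* Main.v *)
Require Import Defs.
From HB Require Import structures.
From mathcomp Require Import all_boot all_order all_algebra.
From mathcomp Require Import all_classical all_reals all_analysis.
From mathcomp Require Import complex.
From mathcomp Require Import ring lra.

Import Order.TTheory GRing.Theory Num.Theory numFieldNormedType.Exports.

Local Open Scope classical_set_scope.
Local Open Scope complex_scope.
Local Open Scope ring_scope.

(* Put g_i = (z^(a_i) - 1) / (z - 1) and f_n(z) = z - r + sum_(i < n) 1 / g_i(z).
   The Coxeter polynomial is (prod_(i <= r) g_i) f_(r+1), and Q is
   (z - 1)^(k+1) (prod_(i <= k) g_i) f_(k+1). For zeros z, w of f_n,
     (z w^* - 1) (sum_(i < n) sum_(j < a_i) (z^j / g_i(z)) (w^j / g_i(w))^*
                  - (r - 1)) + (r + 1 - n) (z - 1) (w^* - 1) = 0.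
   Outside the closed unit disc one can divide by z w^* - 1: this is a positive
   kernel minus the constant r - 1. Taking the second difference over the pairs
   from {z, w} cancels the constant and leaves a sum of squares
   |z^j / g_i(z) - w^j / g_i(w)|^2 bounded above by 0, so j = 0, 1 give z = w:
   f_n has at most one zero outside the disc. On the unit circle, w = z turns the
   identity into (r + 1 - n) |z - 1|^2 = 0; hence the zeros of Q on the circle
   are roots of unity, which are not conjugate to a real number theta > 1.
   Finally f_(k+1)(1) < 0 < f_(k+1)(r) yields theta, and as g_i >= a_i on
   [1, +oo[, f_(r+1) exceeds f_(k+1) there by at most r / min_(i > k) a_i; this
   traps the Salem root just below theta. *)

(** * Clearing denominators: the Coxeter polynomial and Q in terms of f_n *)

Definition star_poly (K : nzRingType) (r n : nat) (a : nat -> nat) : {poly K} :=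
  ('X - r%:R) * \prod_(i < n) geom_poly K (a i)
  + \sum_(i < n) \prod_(j < n | j != i) geom_poly K (a j).

Definition star_fun (K : fieldType) (r n : nat) (a : nat -> nat) (z : K) : K :=
  z - r%:R + \sum_(i < n) ((geom_poly K (a i)).[z])^-1.

Lemma mulX_geom_poly (K : comNzRingType) (n : nat) :
  (0 < n)%N -> 'X * geom_poly K n.-1 = geom_poly K n - 1.
Proof.
case: n => // n _; rewrite /geom_poly big_ord_recl /= expr0 addrC addKr mulr_sumr.
by apply: eq_bigr => i _; rewrite exprS.
Qed.

Lemma geom_polyM (K : comNzRingType) (n : nat) :
  ('X - 1) * geom_poly K n = 'X^n - 1.
Proof. by rewrite subrX1. Qed.

(** As X g_(a-1) = g_a - 1 for g_a = [geom_poly K a], each summand is the full product P minus a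
    product with one factor missing; the r + 1 copies of P turn X + 1 into X - r. *)
Lemma coxeter_polyE_star (K : comNzRingType) (r : nat) (a : nat -> nat) :
  (forall i : 'I_r.+1, (0 < a i)%N) ->
  coxeter_poly K r a = star_poly K r r.+1 a.
Proof.
move=> a_gt0; rewrite /coxeter_poly /star_poly mulr_sumr.
set P := \prod_(i < r.+1) _.
rewrite (eq_bigr (fun i : 'I_r.+1 =>
  P - \prod_(j < r.+1 | j != i) geom_poly K (a j))) => [|i _].
  by rewrite sumrB sumr_const card_ord -(mulr_natr P) -natr1; ring.
by rewrite mulrA (mulX_geom_poly _ _ (a_gt0 i)) mulrBl mul1r /P [in RHS](bigD1 i).
Qed.

(** The same cancellation, once X - 1 is taken out of every factor: X + 1 - r + k loses k + 1 and
    again becomes X - r. Hence a single family f_n, with r kept apart from n, covers both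
    polynomials. *)
Lemma limit_polyE_star (K : comNzRingType) (r k : nat) (a : nat -> nat) :
  (forall i : 'I_k.+1, (0 < a i)%N) ->
  limit_poly K r k a = ('X - 1) ^+ k.+1 * star_poly K r k.+1 a.
Proof.
move=> a_gt0; rewrite /limit_poly /star_poly mulr_sumr.
set P := \prod_(i < k.+1) geom_poly _ _.
have prodE (Q : pred 'I_k.+1) : \prod_(i < k.+1 | Q i) ('X^(a i) - 1 : {poly K}) =
    ('X - 1) ^+ #|Q| * \prod_(i < k.+1 | Q i) geom_poly K (a i).
  by rewrite -prodr_const -big_split /=; apply: eq_bigr => i _; rewrite geom_polyM.
rewrite prodE card_ord -/P.
rewrite (eq_bigr (fun i : 'I_k.+1 => ('X - 1) ^+ k.+1 *
  (P - \prod_(j < k.+1 | j != i) geom_poly K (a j)))) => [|i _].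
  rewrite -mulr_sumr sumrB sumr_const card_ord -(mulr_natr P) -natr1; ring.
rewrite prodE cardC1 card_ord /P [in RHS](bigD1 i) //=.
set S := \prod_(j < k.+1 | _) _; rewrite -geom_polyM.
have -> : geom_poly K (a i) = 'X * geom_poly K (a i).-1 + 1.
  by rewrite (mulX_geom_poly _ _ (a_gt0 i)) subrK.
by rewrite exprSr; ring.
Qed.

Lemma geom_hornerM (K : comNzRingType) (n : nat) (z : K) :
  (z - 1) * (geom_poly K n).[z] = z ^+ n - 1.
Proof. by have := congr1 (horner^~ z) (geom_polyM K n); rewrite !hornerE. Qed.

Lemma geom_horner_neq0 (K : comNzRingType) (n : nat) (z : K) :
  z ^+ n != 1 -> (geom_poly K n).[z] != 0.
Proof. by apply: contraNneq => g0; rewrite -subr_eq0 -geom_hornerM g0 mulr0. Qed.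

Lemma horner_star_poly (K : fieldType) (r n : nat) (a : nat -> nat) (z : K) :
  (forall i : 'I_n, (geom_poly K (a i)).[z] != 0) ->
  (star_poly K r n a).[z] =
    (\prod_(i < n) (geom_poly K (a i)).[z]) * star_fun K r n a z.
Proof.
move=> g0; rewrite /star_poly /star_fun !hornerE horner_prod horner_sum mulrDr.
rewrite -polyC_natr hornerC mulrC mulr_sumr; congr (_ + _).
apply: eq_bigr => i _; rewrite horner_prod [in RHS](bigD1 i) //=.
by rewrite mulrAC mulfV // mul1r.
Qed.

(** * The kernel identity, and zeros outside the unit disc and on the unit circle *)

Lemma rmorph_geom_horner (K L : comNzRingType) (f : {rmorphism K -> L}) (n : nat)
    (z : K) :
  f (geom_poly K n).[z] = (geom_poly L n).[f z].
Proof.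
rewrite /geom_poly !horner_sum rmorph_sum; apply: eq_bigr => j _.
by rewrite !hornerXn rmorphXn.
Qed.

Lemma rmorph_star_fun (K L : fieldType) (f : {rmorphism K -> L}) (r n : nat)
    (a : nat -> nat) (z : K) :
  f (star_fun K r n a z) = star_fun L r n a (f z).
Proof.
rewrite /star_fun rmorphD rmorphB rmorph_nat rmorph_sum; congr (_ + _).
by apply: eq_bigr => i _; rewrite fmorphV rmorph_geom_horner.
Qed.

(* [w] plays the role of the conjugate of a second zero. *)
Lemma star_fun_kernel (K : fieldType) (r n : nat) (a : nat -> nat) (z w : K) :
  (forall i : 'I_n, (geom_poly K (a i)).[z] != 0) ->
  (forall i : 'I_n, (geom_poly K (a i)).[w] != 0) ->
  star_fun K r n a z = 0 -> star_fun K r n a w = 0 ->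
  (z * w - 1) * (\sum_(i < n) \sum_(j < a i)
      (z ^+ j / (geom_poly K (a i)).[z]) * (w ^+ j / (geom_poly K (a i)).[w])
    - (r%:R - 1))
  + (r%:R + 1 - n%:R) * ((z - 1) * (w - 1)) = 0.
Proof.
move=> gz gw; rewrite /star_fun => Ez Ew.
have Sz : \sum_(i < n) ((geom_poly K (a i)).[z])^-1 = r%:R - z.
  by apply/eqP; rewrite -subr_eq0 opprB addrC Ez.
have Sw : \sum_(i < n) ((geom_poly K (a i)).[w])^-1 = r%:R - w.
  by apply/eqP; rewrite -subr_eq0 opprB addrC Ew.
rewrite mulrBr mulr_sumr.
(* The inner sum is geometric, so z w - 1 times it is (z^a w^a - 1) / (g(z) g(w)); substitute z^a =
   1 + (z - 1) g(z) and likewise for w. *)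
rewrite (eq_bigr (fun i : 'I_n => (z - 1) * ((geom_poly K (a i)).[w])^-1
  + (w - 1) * ((geom_poly K (a i)).[z])^-1 + (z - 1) * (w - 1))) => [|i _].
  rewrite !big_split /= -!mulr_sumr Sz Sw sumr_const card_ord.
  rewrite -(mulr_natr (w - 1)); ring.
rewrite (eq_bigr (fun j : 'I_(a i) =>
    ((geom_poly K (a i)).[z] * (geom_poly K (a i)).[w])^-1
  * (z * w) ^+ j)) => [|j _].
  rewrite -mulr_sumr mulrCA -subrX1 exprMn.
  have -> : z ^+ a i = 1 + (z - 1) * (geom_poly K (a i)).[z].
    by rewrite geom_hornerM; ring.
  have -> : w ^+ a i = 1 + (w - 1) * (geom_poly K (a i)).[w].
    by rewrite geom_hornerM; ring.
  by field; rewrite gz gw.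
by rewrite exprMn; field; rewrite gz gw.
Qed.

Lemma expr_norm_gt1 (C : numClosedFieldType) (z : C) (n : nat) :
  1 < `|z| -> (0 < n)%N -> z ^+ n != 1.
Proof.
move=> z1 n0; apply/eqP => zn.
have : 1 < `|z| ^+ n by rewrite exprn_egt1 // -lt0n.
by rewrite -normrX zn normr1 ltxx.
Qed.

Lemma mulrC_norm_gt1 (C : numClosedFieldType) (z w : C) :
  1 < `|z| -> 1 < `|w| -> z * w^* - 1 != 0.
Proof.
move=> z1 w1; rewrite subr_eq0; apply/eqP => zw.
have : 1 < `|z| * `|w| by rewrite mulr_egt1.
by rewrite -(norm_conjC w) -normrM zw normr1 ltxx.
Qed.

(** For |z|, |w| > 1, expanding 1 / (z w^* - 1) in powers of 1 / (z w^* ) gives the sum over j >= 1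
    of (z - 1) z^(-j) times the conjugate of (w - 1) w^(-j): a weighted Szegő kernel of the exterior
    of the disc, hence positive. *)
Definition disc_kernel (C : numClosedFieldType) (z w : C) : C :=
  (z - 1) * (w^* - 1) / (z * w^* - 1).

Lemma disc_kernel_ge0 (C : numClosedFieldType) (z w : C) :
  1 < `|z| -> 1 < `|w| ->
  0 <= disc_kernel C z z - disc_kernel C z w - disc_kernel C w z + disc_kernel C w w.
Proof.
move=> z1 w1; rewrite /disc_kernel.
have zz := mulrC_norm_gt1 _ z z z1 z1; have zw := mulrC_norm_gt1 _ z w z1 w1.
have wz := mulrC_norm_gt1 _ w z w1 z1; have ww := mulrC_norm_gt1 _ w w w1 w1.
have pos (x : C) : 1 < `|x| -> 0 < x * x^* - 1.
  by move=> x1; rewrite subr_gt0 -normCK exprn_egt1.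
(* Complete the square in the first variable; the remainder is controlled by
   |z w^* - 1|^2 - (|z|^2 - 1) (|w|^2 - 1) = |z - w|^2. *)
pose u := (z - 1) / (z * z^* - 1) - (w - 1) / (w * z^* - 1).
pose v := (w - 1) * (z - w) / (w * z^* - 1).
have uC : u^* = (z^* - 1) / (z * z^* - 1) - (w^* - 1) / (z * w^* - 1).
  rewrite /u !(rmorphB, rmorphM, fmorphV, rmorph1) /= !conjCK.
  by rewrite [z^* * z]mulrC [w^* * z]mulrC.
have vC : v^* = (w^* - 1) * (z^* - w^*) / (z * w^* - 1).
  rewrite /v !(rmorphB, rmorphM, fmorphV, rmorph1) /= !conjCK.
  by rewrite [w^* * z]mulrC.
rewrite [leRHS](_ : _ = (z * z^* - 1) * (u * u^*) + (v * v^*) / (w * w^* - 1)).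
  apply: addr_ge0; first by rewrite mulr_ge0 ?mul_conjC_ge0 // ltW ?pos.
  by rewrite divr_ge0 ?mul_conjC_ge0 // ltW ?pos.
rewrite uC vC /u /v; move: zz zw wz ww; set z' := z^*; set w' := w^* => *.
by field; apply/and4P.
Qed.

Lemma star_fun_uniq (C : numClosedFieldType) (r n : nat) (a : nat -> nat) (i0 : 'I_n)
    (z w : C) :
  (n <= r.+1)%N -> (forall i : 'I_n, (0 < a i)%N) -> (1 < a i0)%N ->
  1 < `|z| -> 1 < `|w| ->
  star_fun C r n a z = 0 -> star_fun C r n a w = 0 -> z = w.
Proof.
move=> nr a_gt0 ai0 z1 w1 Ez Ew.
pose g i x := (geom_poly C (a i)).[x].
have g0 (x : C) (i : 'I_n) : 1 < `|x| -> g i x != 0.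
  by move=> x1; rewrite geom_horner_neq0 ?expr_norm_gt1.
have gC i x : g i x^* = (g i x)^* by rewrite /g rmorph_geom_horner.
pose e (i j : nat) (x : C) := x ^+ j / g i x.
have eC i j x : e i j x^* = (e i j x)^*.
  by rewrite /e gC rmorphM fmorphV rmorphXn.
pose d : C := r%:R + 1 - n%:R.
have d_ge0 : 0 <= d by rewrite subr_ge0 natr1 ler_nat.
pose D := disc_kernel C.
pose S (x y : C) := \sum_(i < n) \sum_(j < a i) e i j x * (e i j y)^*.
have ker (x y : C) : 1 < `|x| -> 1 < `|y| -> star_fun C r n a x = 0 ->
    star_fun C r n a y = 0 ->
    d * D x y + S x y = r%:R - 1.
  move=> x1 y1 Ex Ey; have xy := mulrC_norm_gt1 _ x y x1 y1.
  have gx (i : 'I_n) : g i x != 0 by exact: g0.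
  have gy (i : 'I_n) : g i y^* != 0 by rewrite gC conjC_eq0 g0.
  have Ey' : star_fun C r n a y^* = 0 by rewrite -rmorph_star_fun Ey rmorph0.
  have := star_fun_kernel C r n a x y^* gx gy Ex Ey'.
  rewrite (eq_bigr (fun i : 'I_n => \sum_(j < a i) e i j x * (e i j y)^*)) => [|i _].
    rewrite /D /disc_kernel -/d -/(S x y) => K0; apply: (mulfI xy).
    by rewrite mulrDr -[LHS](subrK ((x * y^* - 1) * (r%:R - 1))) -[RHS]add0r -{1}K0; field.
  by apply: eq_bigr => j _; rewrite -eC.
(* This sum is the second difference of [S]. By [ker], adding d times that of [D] gives (r - 1)(1 -
   1 - 1 + 1) = 0; both terms are nonnegative, as n <= r + 1 makes d >= 0. *)
have sum0 : \sum_(i < n) \sum_(j < a i) (e i j z - e i j w) * (e i j z - e i j w)^* = 0.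
  have sge0 : 0 <= \sum_(i < n) \sum_(j < a i) (e i j z - e i j w) * (e i j z - e i j w)^*.
    by apply: sumr_ge0 => i _; apply: sumr_ge0 => j _; rewrite mul_conjC_ge0.
  apply/eqP; rewrite eq_le sge0 andbT -(lerD2l (d * (D z z - D z w - D w z + D w w))).
  rewrite addr0; apply: le_trans (mulr_ge0 d_ge0 (disc_kernel_ge0 _ _ _ z1 w1)).
  have kzz := ker z z z1 z1 Ez Ez; have kzw := ker z w z1 w1 Ez Ew.
  have kwz := ker w z w1 z1 Ew Ez; have kww := ker w w w1 w1 Ew Ew.
  rewrite (_ : \sum_(i < n) _ = S z z - S z w - S w z + S w w).
    rewrite (_ : _ + _ = (d * D z z + S z z) - (d * D z w + S z w)
      - (d * D w z + S w z) + (d * D w w + S w w)); last by rewrite /D; ring.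
    by rewrite kzz kzw kwz kww subrr sub0r addNr.
  rewrite /S.
  rewrite -!sumrB -big_split /=; apply: eq_bigr => i _.
  rewrite -!sumrB -big_split /=; apply: eq_bigr => j _.
  by rewrite rmorphB /=; ring.
have e_eq (j : 'I_(a i0)) : e i0 j z = e i0 j w.
  have s0 i : 0 <= \sum_(j < a i) (e i j z - e i j w) * (e i j z - e i j w)^*.
    by apply: sumr_ge0 => ? _; rewrite mul_conjC_ge0.
  have /eqP := sum0; rewrite psumr_eq0 // => /allP/(_ i0 (mem_index_enum _)).
  rewrite psumr_eq0 => [|? _]; last by rewrite mul_conjC_ge0.
  move=> /allP/(_ j (mem_index_enum _)) /=.
  by rewrite mul_conjC_eq0 subr_eq0 => /eqP.
(* The entry j = 0 gives 1 / g(z) = 1 / g(w), and then j = 1 gives z = w. *)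
have := e_eq (Ordinal ai0); have := e_eq (Ordinal (ltnW ai0)).
rewrite /e /= !expr0 !expr1 !mul1r => -> /mulIf; apply.
by rewrite invr_neq0 // g0.
Qed.

(** On the circle z z^* - 1 = 0 removes the kernel term. The remaining coefficient r + 1 - n is
    nonzero because n <= r; it vanishes in the Coxeter case n = r + 1. *)
Lemma star_fun_unit_circle (C : numClosedFieldType) (r n : nat) (a : nat -> nat)
    (z : C) :
  (n <= r)%N -> `|z| = 1 ->
  (forall i : 'I_n, (geom_poly C (a i)).[z] != 0) ->
  star_fun C r n a z = 0 -> z = 1.
Proof.
move=> nr z1 gz Ez.
have gzC (i : 'I_n) : (geom_poly C (a i)).[z^*] != 0.
  by rewrite -rmorph_geom_horner conjC_eq0.
have EzC : star_fun C r n a z^* = 0 by rewrite -rmorph_star_fun Ez rmorph0.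
have := star_fun_kernel C r n a z z^* gz gzC Ez EzC.
rewrite -normCK z1 expr1n subrr mul0r add0r => /eqP.
have -> : z^* - 1 = (z - 1)^* by rewrite rmorphB rmorph1.
rewrite mulf_eq0 mul_conjC_eq0 subr_eq0 natr1 eqr_nat gtn_eqF //=.
by rewrite subr_eq0 => /eqP.
Qed.

(** * Roots, change of coefficients, monicity and rational divisibility *)

Lemma root_star_poly (K : fieldType) (r n : nat) (a : nat -> nat) (z : K) :
  (forall i : 'I_n, (geom_poly K (a i)).[z] != 0) ->
  root (star_poly K r n a) z = (star_fun K r n a z == 0).
Proof.
move=> gz; rewrite /root horner_star_poly // mulf_eq0.
by rewrite (negPf (_ : \prod_(i < n) _ != 0)) //; apply/prodf_neq0.
Qed.

Lemma root_limit_poly (K : fieldType) (r k : nat) (a : nat -> nat) (z : K) :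
  (forall i : 'I_k.+1, (0 < a i)%N) ->
  root (limit_poly K r k a) z = (z == 1) || root (star_poly K r k.+1 a) z.
Proof.
move=> a_gt0; rewrite (limit_polyE_star _ _ _ _ a_gt0) rootM.
rewrite root_exp ?commr_polyX //; last exact: mulrC.
by rewrite -[1]polyC1 root_XsubC.
Qed.

Lemma map_geom_poly (K L : nzRingType) (f : {rmorphism K -> L}) (n : nat) :
  map_poly f (geom_poly K n) = geom_poly L n.
Proof.
by rewrite /geom_poly rmorph_sum; apply: eq_bigr => j _; rewrite /= map_polyXn.
Qed.

(** Lets integrality over [int], conjugacy over [rat], sign changes over [R] and roots in [R[i]] all
    refer to the same polynomial. *)
Lemma map_star_poly (K L : comNzRingType) (f : {rmorphism K -> L}) (r n : nat)
    (a : nat -> nat) :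
  map_poly f (star_poly K r n a) = star_poly L r n a.
Proof.
rewrite /star_poly rmorphD rmorphM rmorphB /= map_polyX rmorph_nat rmorph_prod.
rewrite rmorph_sum; congr (_ * _ + _).
  by apply: eq_bigr => i _; rewrite /= map_geom_poly.
apply: eq_bigr => i _; rewrite rmorph_prod.
by apply: eq_bigr => j _; rewrite /= map_geom_poly.
Qed.

Lemma size_geom_poly (K : nzRingType) (n : nat) : size (geom_poly K n) = n.
Proof.
have -> : geom_poly K n = \poly_(i < n) 1.
  by rewrite poly_def; apply: eq_bigr => i _; rewrite scale1r.
case: n => [|n]; first by rewrite poly_def big_ord0 size_poly0.
by rewrite size_poly_eq // oner_neq0.
Qed.

Lemma geom_poly_monic (K : nzRingType) (n : nat) :
  (0 < n)%N -> geom_poly K n \is monic.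
Proof.
move=> n0; rewrite monicE lead_coefE size_geom_poly /geom_poly coef_sum.
case: n n0 => // n _; rewrite big_ord_recr big1 /= => [|i _].
  by rewrite add0r coefXn eqxx.
by rewrite coefXn gtn_eqF.
Qed.

(** The first term leads: every product in the second sum divides the product of all g_i, so its
    degree is below that of the first term. *)
Lemma star_poly_monic (K : comNzRingType) (r n : nat) (a : nat -> nat) :
  (forall i : 'I_n, (0 < a i)%N) -> star_poly K r n a \is monic.
Proof.
move=> a_gt0; rewrite /star_poly.
have geom_monic (i : 'I_n) : geom_poly K (a i) \is monic.
  by rewrite geom_poly_monic.
have prod_monic (P : pred 'I_n) : \prod_(i < n | P i) geom_poly K (a i) \is monic.
  by apply: monic_prod => i _.
have lin_monic : 'X - r%:R \is (@monic K) by rewrite -polyC_natr monicXsubC.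
rewrite monicE lead_coefDl ?(eqP (monicMl _ _)) //.
  by rewrite -monicE monicMl.
rewrite size_monicM ?monic_neq0 // -polyC_natr size_XsubC add2n /= ltnS.
apply: (leq_trans (size_sum _ _ _)); apply/bigmax_leqP => i _.
rewrite [leqRHS](_ : _ =
  size (\prod_(j < n | j != i) geom_poly K (a j) * geom_poly K (a i))).
  by rewrite size_monicM ?monic_neq0 // size_geom_poly -subn1 -addnBA // leq_addr.
by rewrite [in RHS]mulrC [in LHS](bigD1 i).
Qed.

(** Otherwise p and q are coprime over [rat], hence over K, and share no root. *)
Lemma irreducible_dvdp_root (K : numFieldType) (p q : {poly rat}) (x : K) :
  irreducible_poly p -> root (map_poly ratr p) x -> root (map_poly ratr q) x ->
  p %| q.
Proof.
move=> p_irr px qx; apply: contraTT (qx).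
rewrite -irreducible_poly_coprime // -(coprimep_map (@ratr K)) => pq.
exact: coprimep_root pq px.
Qed.

(** * Sign changes and real zeros of f_n on [1, +oo[ *)

Lemma geom_horner_ge (K : numDomainType) (n : nat) (t : K) :
  1 <= t -> n%:R <= (geom_poly K n).[t].
Proof.
move=> t1; rewrite /geom_poly horner_sum -[n in n%:R]card_ord -sumr_const.
by apply: ler_sum => j _; rewrite hornerXn exprn_ege1.
Qed.

Lemma geom_horner_gt0 (K : numDomainType) (n : nat) (t : K) :
  (0 < n)%N -> 1 <= t -> 0 < (geom_poly K n).[t].
Proof. by move=> n0 t1; apply: lt_le_trans (geom_horner_ge _ _ _ t1); rewrite ltr0n. Qed.

(** The g_i are positive on [1, +oo[, so [star_poly] has the sign of f_n there and the intermediate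
    value theorem for polynomials applies. *)
Lemma star_fun_ivt (R : rcfType) (r n : nat) (a : nat -> nat) (s t : R) :
  (forall i : 'I_n, (0 < a i)%N) -> 1 <= s -> s <= t ->
  star_fun R r n a s < 0 -> 0 < star_fun R r n a t ->
  exists x, [/\ s < x, x < t & star_fun R r n a x = 0].
Proof.
move=> a_gt0 s1 st fs ft.
have g_gt0 x (i : 'I_n) : 1 <= x -> 0 < (geom_poly R (a i)).[x].
  exact: geom_horner_gt0.
have pE x : 1 <= x -> (star_poly R r n a).[x] =
    (\prod_(i < n) (geom_poly R (a i)).[x]) * star_fun R r n a x.
  by move=> x1; rewrite horner_star_poly // => i; rewrite gt_eqF ?g_gt0.
have t1 := le_trans s1 st.
have prod_gt0 x : 1 <= x -> 0 < \prod_(i < n) (geom_poly R (a i)).[x].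
  by move=> x1; apply: prodr_gt0 => i _; exact: g_gt0.
have [|x /andP[sx xt]] := poly_ivt (p := star_poly R r n a) st.
  rewrite !pE // pmulr_rge0 ?prod_gt0 // (ltW ft) andbT.
  by rewrite pmulr_rle0 ?prod_gt0 // ltW.
have x1 := le_trans s1 sx.
rewrite root_star_poly => [/eqP fx|i]; last by rewrite gt_eqF ?g_gt0.
exists x; split=> //.
  by rewrite lt_neqAle sx andbT; apply: contraTneq fs => ->; rewrite fx ltxx.
by rewrite lt_neqAle xt andbT; apply: contraTneq ft => <-; rewrite fx ltxx.
Qed.

Lemma norm_real_complex_gt1 (R : rcfType) (t : R) : 1 < t -> (1 : R[i]) < `|t%:C|.
Proof.
move=> t1; have t1C : (1 : R[i]) < t%:C by rewrite -(rmorph1 (real_complex R)) ltcR.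
by rewrite gtr0_norm // (lt_trans ltr01).
Qed.

Lemma star_fun_real_uniq (R : rcfType) (r n : nat) (a : nat -> nat) (i0 : 'I_n)
    (s t : R) :
  (n <= r.+1)%N -> (forall i : 'I_n, (0 < a i)%N) -> (1 < a i0)%N ->
  1 < s -> 1 < t ->
  star_fun R r n a s = 0 -> star_fun R r n a t = 0 -> s = t.
Proof.
move=> nr a_gt0 ai0 s1 t1 Es Et; apply: (fmorph_inj (real_complex R)).
apply: (star_fun_uniq _ r n a i0) => //; rewrite ?norm_real_complex_gt1 //.
  by rewrite -[LHS](rmorph_star_fun _ _ (real_complex R)) Es rmorph0.
by rewrite -[LHS](rmorph_star_fun _ _ (real_complex R)) Et rmorph0.
Qed.

Lemma geom_horner1 (K : comNzRingType) (n : nat) : (geom_poly K n).[1] = n%:R.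
Proof.
rewrite /geom_poly horner_sum -[n in n%:R]card_ord -sumr_const.
by apply: eq_bigr => j _; rewrite hornerXn expr1n.
Qed.

(** Here g_i(1) = a_i, so the value is at most 1 - r + 1/2 + k/3, which is at most 1/2 - 2k/3 <
    0. *)
Lemma star_fun1_lt0 (R : realFieldType) (r k : nat) (a : nat -> nat) :
  (0 < k < r)%N -> (forall i : 'I_k.+1, (i.+2 <= a i)%N) ->
  star_fun R r k.+1 a 1 < 0.
Proof.
move=> /andP[k0 kr] ai; rewrite /star_fun big_ord_recl /= geom_horner1.
have inv_le m n : (0 < m <= n)%N -> (n%:R : R)^-1 <= m%:R^-1.
  move=> /andP[m0 mn]; rewrite lef_pV2 ?ler_nat // posrE ltr0n //.
  exact: leq_trans mn.
have h0 := inv_le 2 (a 0) (ai ord0).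
have hS : \sum_(i < k) ((geom_poly R (a (lift ord0 i))).[1])^-1 <= k%:R * 3^-1.
  rewrite mulr_natl -[k in _ *+ k]card_ord -sumr_const; apply: ler_sum => i _.
  by rewrite geom_horner1 inv_le // (leq_trans _ (ai (lift ord0 i))).
have k1 : 1 <= k%:R :> R by rewrite ler1n.
have rk : k%:R + 1 <= r%:R :> R by rewrite natr1 ler_nat.
by lra.
Qed.

Lemma star_fun_limit_root (R : rcfType) (r k : nat) (a : nat -> nat) :
  (0 < k < r)%N -> (forall i : 'I_k.+1, (i.+2 <= a i)%N) ->
  exists theta, [/\ 1 < theta, star_fun R r k.+1 a theta = 0
    & forall t, 1 < t -> t < theta -> star_fun R r k.+1 a t < 0].
Proof.
move=> kr ai; have a_gt0 (i : 'I_k.+1) : (0 < a i)%N by exact: leq_trans (ai i).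
have f1 := star_fun1_lt0 R r k a kr ai.
have r1 : 1 <= r%:R :> R by rewrite ler1n (leq_trans _ (proj2 (andP kr))).
have [|x [x1 xr fx]] := star_fun_ivt R r k.+1 a 1 r%:R a_gt0 (lexx _) r1 f1.
  (* At r the linear part vanishes and only positive reciprocals remain. *)
  rewrite /star_fun subrr add0r big_ord_recl ltr_pwDl //.
    by rewrite invr_gt0 geom_horner_gt0 ?(a_gt0 ord0).
  by apply: sumr_ge0 => i _; rewrite invr_ge0 ltW // geom_horner_gt0 ?(a_gt0 (lift ord0 i)).
(* If f were nonnegative at t < x, then t or some point of ]1, t[ would be a second zero. *)
exists x; split=> // t t1 tx; rewrite ltNge; apply/negP.
have uniq y : 1 < y -> star_fun R r k.+1 a y = 0 -> y = x.
  move=> y1 fy; apply: (star_fun_real_uniq _ r k.+1 a ord0) => //.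
    by case/andP: kr => _ kr; rewrite ltnS ltnW.
  exact: (ai ord0).
rewrite le_eqVlt => /orP[/eqP ft|ft].
  by move: tx; rewrite (uniq t) // ltxx.
have [y [y1 yt fy]] := star_fun_ivt R r k.+1 a 1 t a_gt0 (lexx _) (ltW t1) f1 ft.
by move: (lt_trans yt tx); rewrite (uniq y) // ltxx.
Qed.

(** * The Salem and Pisot properties *)

Lemma root_star_poly_norm_gt1 (R : rcfType) (r n : nat) (a : nat -> nat) (i0 : 'I_n)
    (t : R) (z : R[i]) :
  (n <= r.+1)%N -> (forall i : 'I_n, (0 < a i)%N) -> (1 < a i0)%N ->
  1 < t -> star_fun R r n a t = 0 ->
  1 < `|z| -> root (star_poly R[i] r n a) z -> z = t%:C.
Proof.
move=> nr a_gt0 ai0 t1 Et z1; rewrite root_star_poly => [/eqP Ez|i]; last first.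
  by rewrite geom_horner_neq0 // expr_norm_gt1.
apply: (star_fun_uniq _ r n a i0) => //; rewrite ?norm_real_complex_gt1 //.
by rewrite -[LHS](rmorph_star_fun _ _ (real_complex R)) Et rmorph0.
Qed.

Lemma root_star_poly_real (R : rcfType) (r n : nat) (a : nat -> nat) (t : R) :
  (forall i : 'I_n, (0 < a i)%N) -> 1 < t ->
  star_fun R r n a t = 0 -> root (star_poly R[i] r n a) t%:C.
Proof.
move=> a_gt0 t1 Et; rewrite -(map_star_poly _ _ (real_complex R)) fmorph_root.
by rewrite root_star_poly ?Et // => i; rewrite gt_eqF ?geom_horner_gt0 ?(ltW t1).
Qed.

(** Either some g_i vanishes at z, making z a root of unity, or f_n does and z = 1; in the latter
    case any index will do, and [i0] supplies one. *)
Lemma root_star_poly_unit_circle (C : numClosedFieldType) (r n : nat)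
    (a : nat -> nat) (i0 : 'I_n) (z : C) :
  (n <= r)%N -> `|z| = 1 -> root (star_poly C r n a) z ->
  exists i : 'I_n, z ^+ a i = 1.
Proof.
move=> nr z1 rz.
have [/existsP[i /eqP gi]|/existsPn gz] :=
    boolP [exists i : 'I_n, (geom_poly C (a i)).[z] == 0].
  by exists i; apply/eqP; rewrite -subr_eq0 -geom_hornerM gi mulr0.
exists i0; move: rz; rewrite root_star_poly // => /eqP Ez.
by rewrite (star_fun_unit_circle C r n a z) // expr1n.
Qed.

Lemma is_salem_root_star_fun (R : realType) (r : nat) (a : nat -> nat) (t : R) :
  (forall i : 'I_r.+1, (0 < a i)%N) -> (1 < a 0)%N -> 1 < t ->
  star_fun R r r.+1 a t = 0 -> is_salem_root r a t.
Proof.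
move=> a_gt0 a0 t1 Et; split=> //; rewrite (coxeter_polyE_star _ _ _ a_gt0).
  exact: root_star_poly_real.
by move=> z rz z1; apply: (root_star_poly_norm_gt1 R r r.+1 a ord0) rz.
Qed.

Lemma salem_rootE (R : realType) (r : nat) (a : nat -> nat) (t : R) :
  is_salem_root r a t -> salem_root R r a = t.
Proof.
(* The uniqueness clause of one Salem root, applied to another, shows that the set has at most one
   element; [xget] therefore returns t, not its default 0. *)
move=> st; apply: xget_subset1 => // x y [x1 rx _] [y1 ry uy].
by apply: (fmorph_inj (real_complex R)); apply: uy => //; exact: norm_real_complex_gt1.
Qed.

Lemma is_pisot_star_fun (R : realType) (r n : nat) (a : nat -> nat) (i0 : 'I_n)
    (t : R) :
  (n <= r)%N -> (forall i : 'I_n, (0 < a i)%N) -> (1 < a i0)%N ->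
  1 < t -> star_fun R r n a t = 0 -> is_pisot t.
Proof.
move=> nr a_gt0 ai0 t1 Et; split=> //.
  exists (star_poly int r n a); first exact: star_poly_monic.
  rewrite (map_star_poly _ _ intr) root_star_poly ?Et // => i.
  by rewrite gt_eqF ?geom_horner_gt0 ?(ltW t1).
move=> y [p [_ p_irr pt py]] yt.
have root_dvd (q : {poly rat}) : root (map_poly ratr q) t%:C -> root (map_poly ratr q) y.
  move=> qt; apply: root_dvdp py; rewrite dvdp_map.
  exact: irreducible_dvdp_root p_irr pt qt.
have sy : root (star_poly R[i] r n a) y.
  rewrite -(map_star_poly _ _ (@ratr R[i])); apply: root_dvd.
  by rewrite (map_star_poly _ _ (@ratr R[i])) root_star_poly_real.
have rootXn (i : 'I_n) (z : R[i]) :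
    root (map_poly ratr ('X^(a i) - 1 : {poly rat})) z = (z ^+ a i == 1).
  by rewrite rmorphB /= map_polyXn rmorph1 rootE !hornerE subr_eq0.
case: (real_ltgtP (normr_real y) (real1 _)) => // y1.
  by case/eqP: yt; apply: (root_star_poly_norm_gt1 R r n a i0) sy => //; exact: leqW.
have [i yi] := root_star_poly_unit_circle _ r n a i0 y nr y1 sy.
(* In the case |y| = 1, y is a root of unity; by conjugacy X^(a_i) - 1 vanishes at t too,
   contradicting t > 1. *)
have y_cyc : root (map_poly ratr ('X^(a i) - 1 : {poly rat})) y.
  by rewrite rootXn yi.
have := irreducible_dvdp_root _ _ _ _ p_irr py y_cyc.
rewrite -(dvdp_map (@ratr R[i])) => /root_dvdp/(_ pt).
by rewrite rootXn (negPf (expr_norm_gt1 _ _ _ (norm_real_complex_gt1 _ _ t1) _)).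
Qed.

(** * Passage to the limit *)

Lemma star_fun_split (K : fieldType) (r m n : nat) (a : nat -> nat) (z : K) :
  (m <= n)%N ->
  star_fun K r n a z =
    star_fun K r m a z + \sum_(m <= i < n) ((geom_poly K (a i)).[z])^-1.
Proof.
move=> mn; rewrite /star_fun -[RHS]addrA; congr (_ + _).
have sumE p : \sum_(i < p) ((geom_poly K (a i)).[z])^-1 =
    \sum_(0 <= i < p) ((geom_poly K (a i)).[z])^-1 by rewrite big_mkord.
by rewrite !sumE (big_cat_nat (leq0n m) mn).
Qed.

Lemma eq_star_fun (K : fieldType) (r n : nat) (a b : nat -> nat) (z : K) :
  (forall i : 'I_n, a i = b i) -> star_fun K r n a z = star_fun K r n b z.
Proof. by move=> ab; congr (_ + _); apply: eq_bigr => i _; rewrite ab. Qed.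

Lemma near_salem_root (R : realType) (r k : nat) (a : nat -> nat) (s theta : R) :
  (0 < k < r)%N -> (forall i : 'I_k.+1, (i.+2 <= a i)%N) ->
  1 < s -> s < theta ->
  star_fun R r k.+1 a s < 0 -> star_fun R r k.+1 a theta = 0 ->
  \forall b \near long_arms_filter r k a,
    [/\ is_salem_root r b (salem_root R r b), s < salem_root R r b
      & salem_root R r b < theta].
Proof.
move=> /andP[k0 kr] ai s1 st fs ft.
(* Chosen so that r / N < -f_(k+1)(s): the at most r additional reciprocals, each at most 1 / N,
   cannot make f_(r+1)(s) nonnegative. The successor ensures N > 0. *)
pose N := (Num.bound (r%:R / - star_fun R r k.+1 a s)).+1.
have N_gt0 : 0 < N%:R :> R by rewrite ltr0n.
have rN : r%:R / N%:R < - star_fun R r k.+1 a s.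
  rewrite ltr_pdivrMr // mulrC -ltr_pdivrMr ?oppr_gt0 //.
  apply: lt_trans (archi_boundP _) _; last by rewrite ltr_nat.
  by rewrite divr_ge0 // oppr_ge0 ltW.
exists N => // b [ba _ bN].
have b_gt0 (i : 'I_r.+1) : (0 < b i)%N.
  have [ik|ki] := leqP i k.
    by rewrite ba // (leq_trans _ (ai (Ordinal (ik : (i < k.+1)%N)))).
  by rewrite (leq_trans _ (bN i _)) // ki -ltnS ltn_ord.
have b0 : (1 < b 0)%N by rewrite ba // (ai ord0).
have eq_ab z : star_fun R r k.+1 b z = star_fun R r k.+1 a z.
  by apply: eq_star_fun => i; rewrite ba // -ltnS.
have kr1 : (k.+1 <= r.+1)%N by rewrite ltnS ltnW.
have t1 := lt_trans s1 st.
have fbs : star_fun R r r.+1 b s < 0.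
  rewrite (star_fun_split _ _ _ _ _ _ kr1) eq_ab -ltrBrDl sub0r.
  apply: le_lt_trans rN.
  apply: (@le_trans _ _ (\sum_(k.+1 <= i < r.+1) N%:R^-1)).
    rewrite big_nat [leRHS]big_nat; apply: ler_sum => i /andP[ki ir].
    have Nb : N%:R <= (b i)%:R :> R by rewrite ler_nat bN // ki -ltnS.
    rewrite lef_pV2 ?posrE //; last first.
      by rewrite geom_horner_gt0 ?(b_gt0 (Ordinal ir)) ?ltW.
    exact: le_trans Nb (geom_horner_ge _ _ _ (ltW s1)).
  rewrite sumr_const_nat subSS -[leLHS]mulr_natl ler_wpM2r ?invr_ge0 ?ler0n //.
  by rewrite ler_nat leq_subr.
have fbt : 0 < star_fun R r r.+1 b theta.
  rewrite (star_fun_split _ _ _ _ _ _ kr1) eq_ab ft add0r.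
  have pos i : (k < i < r.+1)%N -> 0 < ((geom_poly R (b i)).[theta])^-1.
    move=> /andP[_ ir].
    by rewrite invr_gt0 geom_horner_gt0 ?(b_gt0 (Ordinal ir)) ?ltW.
  (* Arm k + 1 exists since k < r; its reciprocal makes the sum strictly positive. *)
  rewrite big_nat_recl // ltr_pwDl // ?pos ?ltnSn //.
  by rewrite big_nat sumr_ge0 // => i /andP[ki ir]; rewrite ltW // pos // leqW.
have [x [sx xt fx]] := star_fun_ivt R r r.+1 b s theta b_gt0 (ltW s1) (ltW st) fbs fbt.
have sal := is_salem_root_star_fun R r b x b_gt0 b0 (lt_trans s1 sx) fx.
by rewrite (salem_rootE R r b x sal).
Qed.

Theorem theorem3 (R : realType) (r k : nat) (a : nat -> nat)
  (hr : (1 <= r)%N) (hk : (1 <= k <= r - 1)%N)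
  (ha0 : (2 <= a 0)%N)
  (ha : forall i : nat, (i < r)%N -> (a i < a i.+1)%N) :
  exists theta : R,
    [/\ is_dominant_root (limit_poly R[i] r k a) theta,
        is_pisot theta,
        \forall b \near long_arms_filter r k a,
          is_salem_root r b (salem_root R r b)
      & salem_root R r b @[b --> long_arms_filter r k a] --> theta].
Proof.
have kr : (0 < k < r)%N by case: r hr hk {ha} => // r _; rewrite subn1.
have ai (i : 'I_k.+1) : (i.+2 <= a i)%N.
  have ir : (i < r)%N by case/andP: kr => _; apply: leq_ltn_trans; rewrite -ltnS.
  elim: (nat_of_ord i) ir => // j IHj jr.
  by apply: leq_ltn_trans (ha j (ltnW jr)); apply/IHj/ltnW.
have a_gt0 (i : 'I_k.+1) : (0 < a i)%N by exact: leq_trans (ai i).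
have [theta [t1 ft f_lt0]] := star_fun_limit_root R r k a kr ai.
have k1r : (k.+1 <= r)%N by case/andP: kr.
have near_root s : 1 < s -> s < theta -> \forall b \near long_arms_filter r k a,
    [/\ is_salem_root r b (salem_root R r b), s < salem_root R r b
      & salem_root R r b < theta].
  by move=> s1 st; apply: near_salem_root => //; exact: f_lt0.
exists theta; split.
(* The other roots of Q are 1 or zeros of [star_poly] in the closed unit disc, so their modulus is
   at most 1 < theta. *)
- split; first by rewrite root_limit_poly // root_star_poly_real ?orbT.
  have t1C := norm_real_complex_gt1 _ _ t1.
  move=> y; rewrite root_limit_poly // => /orP[/eqP -> _|ry yt].
    by rewrite normr1.
  apply: le_lt_trans t1C; rewrite real_leNgt ?normr_real ?real1 //.
  apply: contraNN yt => y1; apply/eqP.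
  by apply: (root_star_poly_norm_gt1 R r k.+1 a ord0) ry => //; exact: leqW.
- exact: (is_pisot_star_fun R r k.+1 a ord0).
- have [s1 st] := midf_lt t1.
  by apply: filterS (near_root _ s1 st) => b [].
- apply/cvgrPdist_lt => e e0.
  (* The bound theta - e gives the required closeness; the midpoint of 1 and theta keeps s above
     1. *)
  pose s := Num.max (theta - e) ((1 + theta) / 2).
  have [m1 mt] := midf_lt t1.
  have s1 : 1 < s by rewrite lt_max m1 orbT.
  have st : s < theta by rewrite gt_max mt gtrBl e0.
  apply: filterS (near_root _ s1 st) => b [_ sb bt].
  rewrite gtr0_norm ?subr_gt0 // ltrBlDr -ltrBlDl.
  by apply: le_lt_trans sb; rewrite le_max lexx.
Qed.
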